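(* Let $\mathcal{I}$ be a symmetric operator ideal. Then $\mathcal{I}$ is an injective operator ideal if and only if its polynomial dual $\mathcal{I}^{\mathcal{P}-dual}$ is an injective polynomial ideal.
   Context: All Banach spaces are over $\mathbb{K}=\mathbb{R}$ or $\mathbb{C}$. For Banach spaces $E,F$ and $m\in\mathbb{N}$, $\mathcal{L}(E;F)$ is the space of bounded linear operators and $\mathcal{P}(^mE;F)$ the space of continuous $m$-homogeneous polynomials from $E$ to $F$ with the sup norm over the closed unit ball; $\mathcal{P}(^mE)=\mathcal{P}(^mE;\mathbb{K})$; $E^*$ is the topological dual of $E$. An operator ideal (in the sense of Pietsch) is a subclass $\mathcal{I}$ of the class of bounded linear operators between Banach spaces such that each component $\mathcal{I}(E;F)=\mathcal{L}(E;F)\cap\mathcal{I}$ is a linear subspace of $\mathcal{L}(E;F)$ containing the finite rank operators, and $t\circ v\circ u\in\mathcal{I}(E;H)$ whenever $t\in\mathcal{L}(G;H)$, $v\in\mathcal{I}(F;G)$, $u\in\mathcal{L}(E;F)$. The dual ideal $\mathcal{I}^{dual}$ consists of the operators $u\in\mathcal{L}(E;F)$ whose adjoint $u^*$ belongs to $\mathcal{I}(F^*;E^* )$. An operator ideal is symmetric if $\mathcal{I}=\mathcal{I}^{dual}$. For $P\in\mathcal{P}(^mE;F)$, the Aron-Schottenloher adjoint is the bounded linear operator $P^*\colon F^*\to\mathcal{P}(^mE)$, $P^*(\varphi)(x)=\varphi(P(x))$. The polynomial dual of $\mathcal{I}$ is defined by $$\mathcal{I}^{\mathcal{P}-dual}(^mE;F)=\{P\in\mathcal{P}(^mE;F):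 P^*\in\mathcal{I}(F^*;\mathcal{P}(^mE))\}.$$ A polynomial ideal is a class $\mathcal{Q}$ of continuous homogeneous polynomials between Banach spaces such that each component $\mathcal{Q}(^mE;F):=\mathcal{P}(^mE;F)\cap\mathcal{Q}$ is a linear subspace of $\mathcal{P}(^mE;F)$ containing the polynomials of finite type (finite sums $x\mapsto\sum_i\varphi_i(x)^my_i$ with $\varphi_i\in E^*$, $y_i\in F$), and $t\circ P\circ u\in\mathcal{Q}(^mE;H)$ whenever $t\in\mathcal{L}(G;H)$, $P\in\mathcal{Q}(^mF;G)$, $u\in\mathcal{L}(E;F)$. A metric injection is a linear operator $j\colon F\to G$ with $\|j(y)\|=\|y\|$ for all $y\in F$. A polynomial ideal $\mathcal{Q}$ is injective if $P\in\mathcal{Q}(^mE;F)$ whenever $P\in\mathcal{P}(^mE;F)$ and $j\colon F\to G$ is a metric injection with $j\circ P\in\mathcal{Q}(^mE;G)$ (for all $m$ and $E,F,G$). An operator ideal $\mathcal{I}$ is injective if $u\in\mathcal{I}(E;F)$ whenever $u\in\mathcal{L}(E;F)$ and $j\colon F\to G$ is a metric injection with $j\circ u\in\mathcal{I}(E;G)$. *)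

(* Defs.v *)
From HB Require Import structures.
From mathcomp Require Import all_boot all_order all_algebra complex.
From mathcomp Require Import boolp classical_sets functions reals topology.
From mathcomp Require Import normedtype.

Set Implicit Arguments.
Unset Strict Implicit.
Unset Printing Implicit Defensive.

Import Order.TTheory GRing.Theory Num.Theory numFieldNormedType.Exports.

Local Open Scope classical_set_scope.
Local Open Scope ring_scope.

Variant scalars := RealScalars | ComplexScalars.

Definition scalar_field (R : realType) (k : scalars) : numFieldType :=
  match k with RealScalars => R | ComplexScalars => R[i]%C end.

(* Norms of K-normed spaces take their values in K, on its nonnegative (real)
   elements; these two maps relate such elements to R, where suprema exist. *)
Definition scal_re (R : realType) (k : scalars) : scalar_field R k -> R :=
  match k with RealScalars => id | ComplexScalars => @complex.Re R end.

Definition scal_of (R : realType) (k : scalars) : R -> scalar_field R k :=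
  match k with RealScalars => id | ComplexScalars => fun r => r%:C%C end.

Section ScalarTheory.
Variables (R : realType) (k : scalars).
Local Notation K := (scalar_field R k).
Implicit Types (a b : K) (r s : R).

Lemma scal_ofK r : scal_re (scal_of k r) = r.
Proof. by case: k. Qed.

Lemma scal_reK a : 0 <= a -> scal_of k (scal_re a) = a.
Proof.
case: k a => //= a; rewrite lecE /= => /andP[/eqP im0 _].
by case: a im0 => x y /= ->.
Qed.

Lemma ler_scal_of r s : (scal_of k r <= scal_of k s) = (r <= s).
Proof. by case: k => //=; rewrite lecR. Qed.

Lemma scal_of0 : scal_of k 0 = 0 :> K.
Proof. by case: k. Qed.

Lemma ler_scal_re a b : 0 <= a -> 0 <= b -> (scal_re a <= scal_re b) = (a <= b).
Proof. by move=> a0 b0; rewrite -ler_scal_of !scal_reK. Qed.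

Lemma scal_complete (F : set_system K^o) : ProperFilter F -> cauchy F -> cvg F.
Proof.
case: k F => [|] F FF; first exact: (@cauchy_cvg R).
move=> /cauchyP cF; apply/cvg_ex => /=.
have cpart (p : R[i]%C -> R) : (forall x y, p (x - y) = p x - p y) ->
    (forall x, (`|p x|%:C <= `|x|)%C) -> cvg (p @ F).
  move=> pB ple; apply: cauchy_cvg; apply/cauchy_exP => e e0.
  have e0C : (0 < e%:C :> R[i])%C by rewrite ltcR.
  have [z Fz] := cF _ e0C; exists (p z); change (F (p @^-1` ball (p z) e)).
  apply: filterS Fz => y; rewrite -!ball_normE /= => zy.
  by rewrite -pB -ltcR; apply: le_lt_trans (ple _) zy.
have /cvg_ex[/= a Fa] : cvg (@complex.Re R @ F).
  apply: cpart => [x y|x]; first by rewrite raddfB.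
  exact: normc_ge_Re.
have /cvg_ex[/= b Fb] : cvg (@complex.Im R @ F).
  apply: cpart => [x y|[x y]]; first by rewrite raddfB.
  by rewrite normc_def /= lecR -sqrtr_sqr ler_wsqrtr// lerDr sqr_ge0.
exists (a +i* b)%C; apply/(@cvgrPdist_le _ (R[i]%C : numFieldType)^o) => e e0.
have eE : (scal_of ComplexScalars (complex.Re e)) = e.
  by case: e e0 => x y; rewrite ltcE /= => /andP[/eqP -> _].
have e0R : 0 < complex.Re e / 2.
  by move: e0; rewrite -eE /= ltcR => e0; rewrite divr_gt0.
have subRe w : complex.Re ((a +i* b)%C - w) = a - complex.Re w by case: w.
have subIm w : complex.Im ((a +i* b)%C - w) = b - complex.Im w by case: w.
near=> z => /=.
rewrite (complexE (_ - _)) (le_trans (ler_normD _ _))//.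
rewrite -eE /= normrM [`|'i%C|]normc_def /= expr0n expr1n add0r sqrtr1 mul1r.
rewrite !normc_def /= !expr0n !addr0 !sqrtr_sqr -rmorphD /= lecR.
rewrite [leRHS]splitr lerD//.
- by rewrite subRe; near: z; move/cvgrPdist_le : Fa; exact.
- by rewrite subIm; near: z; move/cvgrPdist_le : Fb; exact.
Unshelve. all: by end_near. Qed.

End ScalarTheory.

(* Scalar-valued functions on [E] which are homogeneous of a fixed degree and
   form a linear space closed under pointwise limits; the continuous ones form
   a Banach space for the sup norm over the closed unit ball. *)
Record homog_class (R : realType) (k : scalars)
    (E : normedModType (scalar_field R k)) := HomogClass {
  hclass : set (E -> (scalar_field R k)^o);
  hdegree : nat;
  hclass0 : hclass (fun=> 0);
  hclassP : forall (a : scalar_field R k) f g, hclass f -> hclass g ->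
    hclass (fun x => a *: f x + g x);
  hclassH : forall f, hclass f ->
    forall (a : scalar_field R k) x, f (a *: x) = a ^+ hdegree *: f x;
  hclass_lim : forall (F : set_system (E -> (scalar_field R k)^o)) f,
    ProperFilter F -> F hclass ->
    (forall x, (fun g => g x) @ F --> f x) -> hclass f }.

Section HomogSpace.
Variables (R : realType) (k : scalars).
Local Notation K := (scalar_field R k).
Variables (E : normedModType K) (S : homog_class E).

Definition homog_pred : {pred E -> K^o} :=
  fun f => `[< hclass S f /\ continuous f >].

Record homog_space := HomogSpace {
  homog_fun :> E -> K^o;
  homog_funP : homog_pred homog_fun }.

HB.instance Definition _ := [isSub for homog_fun].
HB.instance Definition _ := [Choice of homog_space by <:].

Lemma homog_submod : submod_closed homog_pred.
Proof.
split=> [|a f g].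
  apply/asboolP; split; first exact: hclass0.
  by move=> x; exact: cvg_cst.
move=> /asboolP[Sf cf] /asboolP[Sg cg]; apply/asboolP; split.
  exact: hclassP.
by move=> x; apply: cvgD; [apply: cvgZr; exact: cf | exact: cg].
Qed.

HB.instance Definition _ := GRing.isSubmodClosed.Build K (E -> K^o) homog_pred
  homog_submod.

HB.instance Definition _ := [SubChoice_isSubLmodule of homog_space by <:].

Implicit Types f g : homog_space.

Lemma homogP f : hclass S f.
Proof. by case: f => f /= /asboolP[]. Qed.

Lemma homog_continuous f : continuous f.
Proof. by case: f => f /= /asboolP[]. Qed.

Definition sup_norm (f : E -> K^o) : K :=
  scal_of k (sup [set scal_re `|f x| | x in [set x : E | `|x| <= 1]]).

Local Notation d := (hdegree S).

Lemma homog_bounded f : exists2 M : K, 0 <= M &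
  forall x, `|x| <= 1 -> `|f x| <= M.
Proof.
have /cvgrPdist_le/(_ 1 ltr01)/nbhs_norm0P[/= e e0 he] := @homog_continuous f 0.
have e20 : 0 < e / 2 by rewrite divr_gt0.
exists (((e / 2) ^- d) * (`|f 0| + 1)).
  by rewrite mulr_ge0 ?addr_ge0 ?invr_ge0 ?exprn_ge0 ?(ltW e20)//.
move=> x x1.
have -> : x = (e / 2)^-1 *: ((e / 2) *: x).
  by rewrite scalerA mulVf ?scale1r// gt_eqF.
rewrite (hclassH (homogP f)) normrZ normrX normfV gtr0_norm// exprVn.
rewrite ler_wpM2l ?invr_ge0 ?exprn_ge0 ?(ltW e20)//.
have := he ((e / 2) *: x); rewrite /= normrZ gtr0_norm// => he1.
have {}he1 : `|f 0 - f ((e / 2) *: x)| <= 1.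
  apply: he1; rewrite (@le_lt_trans _ _ (e / 2))//.
    by rewrite ler_piMr// ltW.
  by rewrite ltr_pdivrMr// ltr_pMr// ltr1n.
rewrite -lerBlDl (le_trans (lerB_dist _ _))//.
by rewrite distrC in he1.
Qed.

Lemma sup_norm_ub f x : `|x| <= 1 -> `|f x| <= sup_norm f.
Proof.
move=> x1; rewrite -[leLHS](@scal_reK R k)// ler_scal_of.
apply: ub_le_sup; last by exists x.
have [M M0 fM] := homog_bounded f.
by exists (scal_re M) => _ [y y1 <-]; rewrite ler_scal_re// fM.
Qed.

Lemma sup_norm_le f (c : K) : 0 <= c ->
  (forall x, `|x| <= 1 -> `|f x| <= c) -> sup_norm f <= c.
Proof.
move=> c0 fc; rewrite -(scal_reK c0) ler_scal_of; apply: ge_sup.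
  by exists (scal_re `|f 0|), 0 => //=; rewrite normr0.
by move=> _ [y y1 <-]; rewrite ler_scal_re// fc.
Qed.

Lemma sup_norm_ge0 f : 0 <= sup_norm f.
Proof. by rewrite (le_trans _ (@sup_norm_ub f 0 _))// normr0. Qed.

Lemma sup_normP f x : `|f x| <= sup_norm f * `|x| ^+ d.
Proof.
have [->|x0] := eqVneq x 0.
  rewrite -[X in f X](scale0r (0 : E)) (hclassH (homogP f)) normrZ normrX.
  by rewrite !normr0 mulrC ler_wpM2r ?exprn_ge0// sup_norm_ub// normr0.
have nx0 : 0 < `|x| by rewrite normr_gt0.
have -> : `|f x| = `|f (`|x|^-1 *: x)| * `|x| ^+ d.
  rewrite (hclassH (homogP f)) normrZ normrX normfV normr_id mulrAC.
  by rewrite -exprMn mulVf ?gt_eqF// expr1n mul1r.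
rewrite ler_wpM2r ?exprn_ge0// sup_norm_ub//.
by rewrite normrZ normfV normr_id mulVf// gt_eqF.
Qed.

Lemma sup_normD f g : sup_norm (f + g : homog_space) <= sup_norm f + sup_norm g.
Proof.
apply: sup_norm_le => [|x x1]; first by rewrite addr_ge0 ?sup_norm_ge0.
by rewrite (le_trans (ler_normD _ _))// lerD ?sup_norm_ub.
Qed.

Lemma sup_normZ (a : K) f : sup_norm (a *: f : homog_space) = `|a| * sup_norm f.
Proof.
have le1 (b : K) g : sup_norm (b *: g : homog_space) <= `|b| * sup_norm g.
  apply: sup_norm_le => [|x x1]; first by rewrite mulr_ge0 ?sup_norm_ge0.
  by rewrite normrZ ler_wpM2l// sup_norm_ub.
apply/eqP; rewrite eq_le le1 andTb.
have [->|a0] := eqVneq a 0; first by rewrite normr0 mul0r sup_norm_ge0.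
rewrite -ler_pdivlMl ?normr_gt0// -normfV.
by rewrite -[in leLHS](scale1r f) -(mulVf a0) -scalerA le1.
Qed.

Lemma sup_norm_eq0 f : sup_norm f = 0 -> f = 0.
Proof.
move=> f0; apply/val_inj/funext => x /=.
by apply/eqP; rewrite -normr_le0 (le_trans (sup_normP f x))// f0 mul0r.
Qed.

HB.instance Definition _ := Lmodule_isNormed.Build K homog_space
  sup_normD sup_normZ sup_norm_eq0.

Lemma homog_normE f : `|f| = sup_norm f.
Proof. by []. Qed.

Lemma homog_complete (F : set_system homog_space) :
  ProperFilter F -> cauchy F -> cvg F.
Proof.
move=> FF /cauchyP cF.
have cptw x : cvg ((fun f : homog_space => f x) @ F).
  apply: scal_complete; apply/cauchy_exP => e e0.
  have e1 : 0 < e / (`|x| ^+ d + 1) by rewrite divr_gt0// ltr_wpDl// exprn_ge0.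
  have [g Fg] := cF _ e1; exists (g x).
  change (F ((fun f : homog_space => f x) @^-1` ball (g x) e)).
  apply: filterS Fg => h; rewrite -!ball_normE /= => gh.
  have := sup_normP (g - h) x; rewrite -homog_normE => /le_lt_trans; apply.
  rewrite ltr_pdivlMr in gh; last by rewrite ltr_wpDl// exprn_ge0.
  by apply: le_lt_trans gh; rewrite ler_wpM2l// lerDl.
pose f0 (x : E) : K^o := lim ((fun f : homog_space => f x) @ F).
have f0lim x : (fun f : homog_space => f x) @ F --> f0 x by exact: cptw.
have unif e : 0 < e -> \forall f \near F,
    forall x, `|homog_fun f x - f0 x| <= e * `|x| ^+ d.
  move=> e0; have e20 : 0 < e / 2 by rewrite divr_gt0.
  have [g Fg] := cF _ e20.
  near=> f => x.
  have gf : ball g (e / 2) f by near: f.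
  have cl : (fun h : homog_space => `|f x - h x|) @ F --> `|f x - f0 x|.
    by apply: cvg_norm; apply: cvgB; [exact: cvg_cst|exact: f0lim].
  have lim_le (u : homog_space -> K^o) (l : K^o) (c : K) : u @ F --> l ->
      (\forall h \near F, `|f x - u h| <= c) -> `|f x - l| <= c.
    move=> ul uc; apply/ler_addgt0Pr => r r0.
    near F => h; rewrite -(subrKA (u h)) (le_trans (ler_normD _ _))// lerD//.
      by near: h.
    by rewrite distrC; near: h; move/cvgrPdist_le : ul; exact.
  apply: (lim_le (fun h : homog_space => h x)); first exact: f0lim.
  apply: filterS (Fg) => h; rewrite -ball_normE /= => gh.
  rewrite -ball_normE /= in gf.
  have := sup_normP (f - h) x; rewrite -homog_normE => /le_trans; apply.
  rewrite ler_wpM2r ?exprn_ge0// -(subrKA g) (le_trans (ler_normD _ _))//.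
  by rewrite [leRHS]splitr lerD// ltW// distrC.
have Sf0 : hclass S f0.
  apply: (@hclass_lim _ _ _ S ((fun f : homog_space => f : E -> K^o) @ F)) => //.
  by apply: nearW => f; exact: homogP.
have cf0 : continuous f0.
  move=> x; apply/cvgrPdist_le => e e0.
  have M0 : 0 < (`|x| + 1) ^+ d by rewrite exprn_gt0// ltr_wpDl.
  have e1 : 0 < e / 3 / (`|x| + 1) ^+ d by rewrite !divr_gt0.
  near F => f.
  have ff0 y : `|y| <= `|x| + 1 -> `|f y - f0 y| <= e / 3.
    have : forall y, `|f y - f0 y| <= e / 3 / (`|x| + 1) ^+ d * `|y| ^+ d.
      by near: f; exact: unif.
    move=> /(_ y)/le_trans ffy yx; apply: ffy.
    by rewrite mulrAC ler_pdivrMr// ler_wpM2l ?divr_ge0 ?(ltW e0)// lerXn2r// nnegrE ?addr_ge0.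
  have e30 : 0 < e / 3 by rewrite divr_gt0.
  near=> y.
  rewrite -(subrKA (f y)) (le_trans (ler_normD _ _))//.
  have -> : e = (e / 3 + e / 3) + e / 3.
    by rewrite -!mulrDl -mulr2n -mulrSr -[e *+ 3]mulr_natr mulfK// pnatr_eq0.
  rewrite lerD//; last first.
    apply: ff0; near: y.
    by apply: (@cvgr_norm_le _ _ _ _ _ id x) => //; rewrite ltrDl.
  rewrite -(subrKA (f x)) (le_trans (ler_normD _ _))// lerD//.
    by rewrite distrC ff0// lerDl.
  by near: y; have /cvgrPdist_le := @homog_continuous f x; exact.
have Pf0 : `[< hclass S f0 /\ continuous f0 >] by apply/asboolP.
apply/cvg_ex; exists (HomogSpace Pf0); apply/cvgrPdist_le => e e0.
near=> f; rewrite homog_normE sup_norm_le ?ltW// => x x1 /=.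
rewrite distrC; have : forall x, `|f x - f0 x| <= e * `|x| ^+ d.
  by near: f; exact: unif.
by move=> /(_ x)/le_trans; apply; rewrite ler_piMr ?exprn_ile1// ltW.
Unshelve. all: by end_near. Qed.

HB.instance Definition _ := Uniform_isComplete.Build homog_space homog_complete.

End HomogSpace.

Section Polynomials.
Variables (K : numFieldType) (m : nat).

(* [A] is linear in each of its [m] variables. *)
Definition multilinear (E F : lmodType K) (A : ('I_m -> E) -> F) : Prop :=
  forall (i : 'I_m) (v : 'I_m -> E),
    linear (fun x : E => A (fun j => if j == i then x else v j)).

Definition algebraic_hpoly (E F : lmodType K) (P : E -> F) : Prop :=
  exists2 A : ('I_m -> E) -> F, multilinear A & forall x, P x = A (fun=> x).

Definition hpoly (E F : normedModType K) (P : E -> F) : Prop :=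
  algebraic_hpoly P /\ continuous P.

End Polynomials.

(* Polarization, used to see that pointwise limits of m-homogeneous
   polynomials are again m-homogeneous polynomials. *)
Section Polarization.
Variables (K : numFieldType) (E F : lmodType K).

Lemma multilinear_sum m (A : ('I_m -> E) -> F) (T : finType)
    (c : 'I_m -> T -> K) (x : T -> E) : multilinear A ->
  A (fun i => \sum_t c i t *: x t) =
  \sum_(g : {ffun 'I_m -> T}) (\prod_i c i (g i)) *: A (fun i => x (g i)).
Proof.
elim: m A c => [|m IH] A c Alin.
  rewrite (big_pred1 [ffun i : 'I_0 => match i with Ordinal _ h => False_rect T (notF h) end]).
    rewrite big_ord0 scale1r; congr A; apply/funext => -[]//.
  by move=> g; apply/esym/eqP/ffunP => -[].
pose cons (z : E) (w : 'I_m -> E) (i : 'I_m.+1) :=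
  if unlift ord0 i is Some j then w j else z.
have consE z w z' : (fun j => if j == ord0 then z else cons z' w j) = cons z w.
  apply/funext => j; rewrite /cons; case: unliftP => [j'|] -> //=.
have Bsum (w : 'I_m -> E) : linear (fun z => A (cons z w)).
  by move=> a u v; have := Alin ord0 (cons 0 w) a u v; rewrite !consE.
pose BL w : {linear E -> F} := HB.pack (fun z => A (cons z w))
  (GRing.isLinear.Build _ _ _ _ _ (Bsum w)).
have Blin z : multilinear (fun w => A (cons z w)).
  move=> i v a u u'.
  have := Alin (lift ord0 i) (cons z v) a u u'.
  have e y : (fun j => if j == lift ord0 i then y else cons z v j) =
      cons z (fun j => if j == i then y else v j).
    apply/funext => j; rewrite /cons; by case: (unliftP ord0 j) => [j'|] ->.
  by rewrite !e.
have -> : (fun i => \sum_t c i t *: x t) =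
    cons (\sum_t c ord0 t *: x t) (fun i => \sum_t c (lift ord0 i) t *: x t).
  by apply/funext => j; rewrite /cons; case: unliftP => [j'|] ->.
transitivity (\sum_t c ord0 t *: A (cons (x t)
    (fun i => \sum_t c (lift ord0 i) t *: x t))).
  set w := fun i : 'I_m => _; rewrite -[LHS]/(BL w _) linear_sum.
  by apply: eq_bigr => t _; rewrite linearZ.
transitivity (\sum_t \sum_(g : {ffun 'I_m -> T})
    (c ord0 t * \prod_i c (lift ord0 i) (g i)) *:
    A (cons (x t) (fun i => x (g i)))).
  apply: eq_bigr => t _.
  rewrite (IH (fun w => A (cons (x t) w)) (fun i => c (lift ord0 i)))//.
  by rewrite scaler_sumr; apply: eq_bigr => g _; rewrite scalerA.
rewrite pair_big /=.
pose h (p : T * {ffun 'I_m -> T}) : {ffun 'I_m.+1 -> T} :=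
  [ffun i => if unlift ord0 i is Some j then p.2 j else p.1].
rewrite [RHS](reindex h)/=; last first.
  exists (fun g => (g ord0, [ffun i => g (lift ord0 i)])) => [[t g] _|g _].
    rewrite /h /= ffunE unlift_none; congr pair; apply/ffunP => i.
    by rewrite !ffunE liftK.
  by apply/ffunP => i; rewrite ffunE; case: unliftP => [j|] -> //=; rewrite ffunE.
apply: eq_bigr => -[t g] _ /=.
rewrite big_ord_recl /h ffunE unlift_none /=; congr (_ *: _).
  by congr (_ * _); apply: eq_bigr => i _; rewrite ffunE liftK.
congr A; apply/funext => i; rewrite /cons ffunE /=.
by case: unliftP.
Qed.

Lemma hpoly_homog m (P : E -> F) : algebraic_hpoly m P ->
  forall (a : K) x, P (a *: x) = a ^+ m *: P x.
Proof.
move=> [A Alin PA] a x; rewrite !PA.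
have := multilinear_sum (fun _ _ => a) (fun _ : unit => x) Alin.
rewrite (_ : (fun i => _) = (fun=> a *: x)); last first.
  by apply/funext => i; rewrite (big_pred1 tt)// => -[].
move=> ->; rewrite (big_pred1 [ffun=> tt]); first by rewrite prodr_const card_ord.
by move=> g; apply/esym/eqP/ffunP => i; case: (g i); rewrite ffunE.
Qed.

Variable m : nat.

Definition pol_sign (S : {set 'I_m}) : K :=
  \prod_(j < m) (if j \in S then 1 else -1).

Definition polarization (P : E -> F) (x : 'I_m -> E) : F :=
  \sum_(S : {set 'I_m}) pol_sign S *: P (\sum_(j in S) x j).

Lemma pol_weight (g : {ffun 'I_m -> 'I_m}) :
  \sum_(S : {set 'I_m}) pol_sign S * \prod_i (g i \in S)%:R =
  (injectiveb g)%:R :> K.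
Proof.
have [/injectiveP gi|/injectiveP gni] := boolP (injectiveb g).
  have gs j : exists i, g i = j.
    by have /codomP[i ->] := injF_onto gi j; exists i.
  rewrite (bigD1 (finset.setTfor 'I_m))//= [X in _ + X]big1 ?addr0.
    rewrite /pol_sign big1 => [|j _]; last by rewrite inE.
    by rewrite mul1r big1// => i _; rewrite inE.
  move=> S /eqP ST; have [j jS] : exists j, j \notin S.
    apply/existsP; rewrite -negb_forall; apply/negP => /forallP SS.
    by apply: ST; apply/finset.setP => j; rewrite SS inE.
  have [i gij] := gs j.
  by rewrite (bigD1 i)//= gij (negbTE jS) mul0r mulr0.
have [j jg] : exists j, j \notin codom g.
  apply/existsP; rewrite -negb_forall; apply/negP => /forallP gs.
  have /eqP/image_injP gi : #|codom g| = #|'I_m|.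
    by apply: eq_card => i; rewrite gs.
  by apply: gni => i i'; exact: gi.
pose flip (S : {set 'I_m}) := if j \in S then (S :\ j)%SET else (j |: S)%SET.
have in_flip S i : (i \in flip S) = if i == j then j \notin S else i \in S.
  rewrite /flip; have [jS|jS] := boolP (j \in S); rewrite !inE.
    by case: (eqVneq i j) => [|_].
  by case: (eqVneq i j) => [|_].
have flipK : involutive flip.
  move=> S; apply/finset.setP => i; rewrite !in_flip eqxx negbK.
  by case: eqVneq => // ->.
have gj i : g i != j by apply: contraNneq jg => <-; exact: codom_f.
set s := LHS; suff : s = - s.
  by move/eqP; rewrite -addr_eq0 -mulr2n mulrn_eq0 /= => /eqP.
rewrite {1}/s (reindex_inj (inv_inj flipK)) /s -sumrN; apply: eq_bigr => S _.
rewrite -mulNr; congr (_ * _); last first.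
  by apply: eq_bigr => i _; rewrite in_flip (negbTE (gj i)).
rewrite /pol_sign (bigD1 j)//= [in RHS](bigD1 j)//= -mulNr; congr (_ * _).
  by rewrite in_flip eqxx; case: (j \in S) => //=; rewrite opprK.
by apply: eq_bigr => i ij; rewrite in_flip (negbTE ij).
Qed.

Lemma polarizationE (A : ('I_m -> E) -> F) (P : E -> F) :
  multilinear A -> (forall x, P x = A (fun=> x)) ->
  forall x, polarization P x =
    \sum_(g : {ffun 'I_m -> 'I_m} | injectiveb g) A (fun i => x (g i)).
Proof.
move=> Alin PA x; rewrite /polarization.
transitivity (\sum_(S : {set 'I_m}) \sum_(g : {ffun 'I_m -> 'I_m})
    (pol_sign S * \prod_i (g i \in S)%:R) *: A (fun i => x (g i))).
  apply: eq_bigr => S _; rewrite PA.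
  rewrite (_ : (fun=> _) = fun i : 'I_m => \sum_j (j \in S)%:R *: x j).
    rewrite (multilinear_sum (fun _ j => (j \in S)%:R)) // scaler_sumr.
    by apply: eq_bigr => g _; rewrite scalerA.
  apply/funext => _; rewrite big_mkcond; apply: eq_bigr => j _.
  by case: (j \in S); rewrite ?scale1r ?scale0r.
rewrite exchange_big /= [RHS]big_mkcond; apply: eq_bigr => g _.
by rewrite -scaler_suml pol_weight; case: ifP; rewrite ?scale1r ?scale0r.
Qed.

Lemma polarization_multilinear (P : E -> F) :
  algebraic_hpoly m P -> multilinear (polarization P).
Proof.
move=> [A Alin PA] i v a x y; rewrite !(polarizationE Alin PA).
rewrite scaler_sumr -big_split /=; apply: eq_bigr => g /injectiveP gi.
have /codomP[i' ii'] := injF_onto gi i.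
have := Alin i' (fun j => v (g j)) a x y.
have e z : (fun j => if j == i' then z else v (g j)) =
    (fun j => if g j == i then z else v (g j)).
  by apply/funext => j; rewrite ii' (inj_eq gi).
by rewrite !e.
Qed.

Definition pol_const : K := (#|[pred g : {ffun 'I_m -> 'I_m} | injectiveb g]|)%:R.

Lemma pol_const_neq0 : pol_const != 0.
Proof.
rewrite /pol_const pnatr_eq0 -lt0n; apply/card_gt0P; exists [ffun i => i].
by rewrite inE; apply/injectiveP => i j; rewrite !ffunE.
Qed.

Lemma polarization_diag (P : E -> F) x :
  algebraic_hpoly m P -> polarization P (fun=> x) = pol_const *: P x.
Proof.
move=> [A Alin PA]; rewrite (polarizationE Alin PA) sumr_const.
by rewrite PA /pol_const scaler_nat.
Qed.

End Polarization.

Section DualAndPolynomialSpaces.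
Variables (R : realType) (k : scalars).
Local Notation K := (scalar_field R k).
Variable E : normedModType K.

Let pointwise_eq (F : set_system (E -> K^o)) (S : set (E -> K^o))
    (lhs rhs : (E -> K^o) -> K^o) (a b : K^o) : ProperFilter F -> F S ->
  (forall f, S f -> lhs f = rhs f) -> lhs @ F --> a -> rhs @ F --> b -> a = b.
Proof.
move=> FF FS lr la rb; apply: (@cvg_unique _ _ (lhs @ F)) => //.
apply: cvg_trans rb; apply: near_eq_cvg; apply: filterS FS => f Sf.
by rewrite lr.
Qed.

Let linear_hom (f : E -> K^o) : linear f ->
  forall (a : K) x, f (a *: x) = a ^+ 1 *: f x.
Proof.
move=> lf a x; have := lf a x 0; rewrite addr0 => ->.
have := lf 1 0 0; rewrite !scale1r addr0 => /eqP.
by rewrite -subr_eq0 opprD addNKr oppr_eq0 => /eqP ->; rewrite addr0.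
Qed.

Let linear0_class : linear ((fun=> 0) : E -> K^o).
Proof. by move=> a x y; rewrite scaler0 addr0. Qed.

Let linearP_class (a : K) (f g : E -> K^o) : linear f -> linear g ->
  linear ((fun x => a *: f x + g x) : E -> K^o).
Proof.
by move=> lf lg b x y; rewrite lf lg !scalerDr !scalerA [b * a]mulrC addrACA.
Qed.

Let linear_lim (F : set_system (E -> K^o)) (f : E -> K^o) : ProperFilter F ->
  F [set g : E -> K^o | linear g] -> (forall x, (fun g => g x) @ F --> f x) -> linear f.
Proof.
move=> FF Flin Ff a x y.
apply: (pointwise_eq FF Flin (lhs := fun g => g (a *: x + y))
  (rhs := fun g => a *: g x + g y)) => //.
  by move=> g /= /(_ a x y).
by apply: cvgD => //; apply: cvgZr.
Qed.

Definition linear_class : homog_class E :=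
  @HomogClass _ _ E [set f : E -> K^o | linear f] 1 linear0_class linearP_class
    linear_hom linear_lim.

Variable m : nat.

Let hpoly0 : algebraic_hpoly m ((fun=> 0) : E -> K^o).
Proof.
by exists (fun=> 0) => // i v a x y; rewrite scaler0 addr0.
Qed.

Let hpolyP (a : K) (f g : E -> K^o) : algebraic_hpoly m f ->
  algebraic_hpoly m g -> algebraic_hpoly m ((fun x => a *: f x + g x) : E -> K^o).
Proof.
move=> [A Alin fA] [B Blin gB]; exists (fun v => a *: A v + B v).
  move=> i v b x y.
  by rewrite Alin Blin !scalerDr !scalerA [b * a]mulrC addrACA.
by move=> x; rewrite fA gB.
Qed.

Let hpoly_lim (F : set_system (E -> K^o)) (f : E -> K^o) : ProperFilter F ->
  F [set g : E -> K^o | algebraic_hpoly m g] -> (forall x, (fun g => g x) @ F --> f x) ->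
  algebraic_hpoly m f.
Proof.
move=> FF Fpoly Ff.
have Fpol v : (fun g : E -> K^o => polarization g v) @ F --> polarization f v.
  rewrite /polarization; apply: cvg_big => [|S _].
    exact: add_continuous.
  by apply: cvgZr.
exists (fun v => (pol_const K m)^-1 *: polarization f v).
  move=> i v a x y; rewrite scalerA [a * _]mulrC -scalerA -scalerDr.
    congr (_ *: _).
  apply: (pointwise_eq FF Fpoly
    (lhs := fun g => polarization g (fun j => if j == i then a *: x + y else v j))
    (rhs := fun g => a *: polarization g (fun j => if j == i then x else v j) +
      polarization g (fun j => if j == i then y else v j))) => //.
    by move=> g /= /polarization_multilinear/(_ i v a x y).
  by apply: cvgD => //; apply: cvgZr.
move=> x; apply: (scalerI (pol_const_neq0 K m)).
rewrite scalerA mulfV ?pol_const_neq0// scale1r.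
apply: (pointwise_eq FF Fpoly (lhs := fun g => pol_const K m *: g x)
  (rhs := fun g => polarization g (fun _ : 'I_m => x))) => //.
  by move=> g /= /polarization_diag ->.
by apply: cvgZr.
Qed.

Definition hpoly_class : homog_class E :=
  @HomogClass _ _ E [set f : E -> K^o | algebraic_hpoly m f] m hpoly0 hpolyP
    (@hpoly_homog K E K^o m) hpoly_lim.

End DualAndPolynomialSpaces.

Definition banach (R : realType) (k : scalars) :=
  completeNormedModType (scalar_field R k).

Section Ideals.
Variables (R : realType) (k : scalars).
Local Notation K := (scalar_field R k).

(* E^*: the continuous linear functionals on E. *)
Definition dual (E : banach R k) : banach R k := homog_space (linear_class E).

(* P(^mE): the continuous m-homogeneous polynomials from E to K. *)
Definition hpoly_space (m : nat) (E : banach R k) : banach R k :=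
  homog_space (hpoly_class E m).

Definition operator (E F : banach R k) (u : E -> F) : Prop :=
  linear u /\ continuous u.

Lemma adjoint_subproof (E F : banach R k) (u : E -> F) (phi : dual F) :
  operator u -> homog_pred (linear_class E) (fun x => phi (u x)).
Proof.
move=> [ulin ucont]; apply/asboolP; split.
  by move=> a x y /=; rewrite ulin (homogP phi).
by move=> x; apply: continuous_comp; [exact: ucont | exact: homog_continuous].
Qed.

Definition adjoint (E F : banach R k) (u : E -> F) (hu : operator u)
    (phi : dual F) : dual E :=
  HomogSpace (adjoint_subproof phi hu).

Lemma hpoly_adjoint_subproof (m : nat) (E F : banach R k) (P : E -> F)
    (phi : dual F) :
  hpoly m P -> homog_pred (hpoly_class E m) (fun x => phi (P x)).
Proof.
move=> [[A Alin PA] Pcont]; apply/asboolP; split.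
  exists (fun v => phi (A v)) => [i v a x y|x]; last by rewrite PA.
  by rewrite Alin (homogP phi).
by move=> x; apply: continuous_comp; [exact: Pcont | exact: homog_continuous].
Qed.

Definition hpoly_adjoint (m : nat) (E F : banach R k) (P : E -> F)
    (hP : hpoly m P) (phi : dual F) : hpoly_space m E :=
  HomogSpace (hpoly_adjoint_subproof phi hP).

Definition finite_rank (E F : banach R k) (u : E -> F) : Prop :=
  operator u /\ exists (n : nat) (y : 'I_n -> F),
    forall x, exists a : 'I_n -> K, u x = \sum_(i < n) a i *: y i.

Definition finite_type (m : nat) (E F : banach R k) (P : E -> F) : Prop :=
  exists (n : nat) (phi : 'I_n -> dual E) (y : 'I_n -> F),
    forall x, P x = \sum_(i < n) (phi i x : K) ^+ m *: y i.

Definition op_class := forall E F : banach R k, set (E -> F).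

(* Classes of homogeneous polynomials, indexed by the degree; degrees are
   positive, and the value at degree 0 plays no role. *)
Definition poly_class := nat -> forall E F : banach R k, set (E -> F).

Record operator_ideal (I : op_class) : Prop := OperatorIdeal {
  op_ideal_operator : forall (E F : banach R k) (u : E -> F), I E F u -> operator u;
  op_ideal_linear : forall (E F : banach R k) (a : K) (u v : E -> F),
    I E F u -> I E F v -> I E F (fun x => a *: u x + v x);
  op_ideal_finite_rank : forall (E F : banach R k) (u : E -> F), finite_rank u -> I E F u;
  op_ideal_comp : forall (E F G H : banach R k)
      (t : G -> H) (v : F -> G) (u : E -> F),
    operator t -> I F G v -> operator u -> I E H (t \o v \o u) }.

Definition dual_ideal (I : op_class) : op_class :=
  fun E F => [set u | exists hu : operator u, I (dual F) (dual E) (adjoint hu)].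

Definition symmetric_ideal (I : op_class) : Prop :=
  forall (E F : banach R k) (u : E -> F), I E F u <-> dual_ideal I u.

Definition polynomial_dual (I : op_class) : poly_class :=
  fun m E F => [set P | exists hP : hpoly m P,
    I (dual F) (hpoly_space m E) (hpoly_adjoint hP)].

Record polynomial_ideal (Q : poly_class) : Prop := PolynomialIdeal {
  poly_ideal_hpoly : forall m (E F : banach R k) (P : E -> F), (0 < m)%N ->
    Q m E F P -> hpoly m P;
  poly_ideal_linear : forall m (E F : banach R k) (a : K) (P P' : E -> F), (0 < m)%N ->
    Q m E F P -> Q m E F P' -> Q m E F (fun x => a *: P x + P' x);
  poly_ideal_finite_type : forall m (E F : banach R k) (P : E -> F), (0 < m)%N ->
    finite_type m P -> Q m E F P;
  poly_ideal_comp : forall m (E F G H : banach R k)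
      (t : G -> H) (P : F -> G) (u : E -> F), (0 < m)%N ->
    operator t -> Q m F G P -> operator u -> Q m E H (t \o P \o u) }.

Definition metric_injection (F G : banach R k) (j : F -> G) : Prop :=
  linear j /\ forall y, `|j y| = `|y|.

Definition injective_operator_ideal (I : op_class) : Prop :=
  operator_ideal I /\
  forall (E F G : banach R k) (u : E -> F) (j : F -> G),
    operator u -> metric_injection j -> I E G (j \o u) -> I E F u.

Definition injective_polynomial_ideal (Q : poly_class) : Prop :=
  polynomial_ideal Q /\
  forall m (E F G : banach R k) (P : E -> F) (j : F -> G), (0 < m)%N ->
    hpoly m P -> metric_injection j -> Q m E G (j \o P) -> Q m E F P.

End Ideals.

(* Main.v *)
(* Hahn-Banach makes the adjoint of a metric injection [j] a metric surjection,
   so that [j^**] is again a metric injection. For a symmetric ideal [I],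
   membership of [P^*] and of [P^**] are equivalent, and [(j P)^* = P^* j^*]
   dualizes to [j^** P^**]; so injectivity of [I] gives that of the polynomial
   dual. Conversely, [P(^1E)] is [E^*], so in degree 1 the polynomial dual of
   [I] is [I^dual = I].

   Hahn-Banach is proved once for real vector spaces and transferred to both
   scalar fields by restriction of scalars: a real-linear functional [g] on a
   complex space is the real part of [x |-> g x - i g (i x)]. *)
From HB Require Import structures.
From mathcomp Require Import all_boot all_order all_algebra complex.
From mathcomp Require Import boolp classical_sets reals topology.
From mathcomp Require Import normedtype.
From mathcomp Require Import ring lra.
Require Import Defs.

Set Implicit Arguments.
Unset Strict Implicit.
Unset Printing Implicit Defensive.

Import Order.TTheory GRing.Theory Num.Theory numFieldNormedType.Exports.

Local Open Scope classical_set_scope.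
Local Open Scope ring_scope.

(** * The Hahn-Banach theorem for sublinear functionals on real vector spaces *)

Section HahnBanach.
Variables (R : realType) (V : lmodType R) (p : V -> R).
Hypothesis p_subadd : forall x y, p (x + y) <= p x + p y.
Hypothesis p_homog : forall r x, 0 < r -> p (r *: x) = r * p x.

(* Domination makes such a subspace of [V * R] the graph of a partial linear
   functional, since [r <= p 0 = 0] and [- r <= 0] for [(0, r)] in it. *)
Definition dominated_graph (M : set (V * R)) : Prop :=
  [/\ M (0, 0),
      forall a x y r s, M (x, r) -> M (y, s) -> M (a *: x + y, a * r + s) &
      forall x r, M (x, r) -> r <= p x].

Lemma dominated_graph_fun M x r s : dominated_graph M ->
  M (x, r) -> M (x, s) -> r = s.
Proof.
move=> [M0 ML Mp] xr xs.
have p0 : p 0 = 0.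
  have := p_homog 0 (ltr0n R 2); rewrite scaler0; lra.
have le (a b : R) : M (x, a) -> M (x, b) -> b <= a.
  move=> xa xb; have := Mp _ _ (ML (-1) _ _ _ _ xa xb).
  by rewrite scaleN1r addNr p0; lra.
by apply/eqP; rewrite eq_le !le.
Qed.

(** A value [a] at [x0] preserves domination when [r - p (x - x0) <= a <= p (y + x0) - s] for all
    [(x, r)] and [(y, s)] in [M]. Subadditivity puts every left side below every right side, so the
    supremum of the left sides serves. *)
Lemma dominated_graph_extend M x0 : dominated_graph M ->
  exists a, dominated_graph [set v | exists x r t,
    M (x, r) /\ v = (x + t *: x0, r + t * a)].
Proof.
move=> [M0 ML Mp].
have MD x y r s : M (x, r) -> M (y, s) -> M (x + y, r + s).
  by move=> xr ys; have := ML 1 _ _ _ _ xr ys; rewrite scale1r mul1r.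
have MZ a x r : M (x, r) -> M (a *: x, a * r).
  by move=> xr; have := ML a _ _ _ _ xr M0; rewrite !addr0.
pose L := [set r | exists2 v, M v & r = v.2 - p (v.1 - x0)].
have Lub y s : M (y, s) -> ubound L (p (y + x0) - s).
  move=> ys _ [[x r] /= xr ->].
  have := Mp _ _ (MD _ _ _ _ xr ys).
  have := p_subadd (x - x0) (y + x0).
  by rewrite addrACA addNr addr0; lra.
have hsL : has_sup L.
  split; first by exists (0 - p (0 - x0)), (0, 0).
  by exists (p (0 + x0) - 0); apply: Lub.
exists (sup L); split.
- by exists 0, 0, 0; rewrite scale0r mul0r !addr0.
- move=> b _ _ _ _ [x [r [t [xr [-> ->]]]]] [y [s [u [ys [-> ->]]]]].
  exists (b *: x + y), (b * r + s), (b * t + u); split; first exact: ML.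
  congr (_, _); last ring.
  by rewrite scalerDr scalerDl scalerA addrACA.
- move=> _ _ [x [r [t [xr [-> ->]]]]].
  (* By positive homogeneity [- t] or [t] factors out: the case [t < 0] reduces to the lower bound
     on [sup L], the case [0 < t] to the upper one. *)
  have [t0|t0|->] := ltgtP t 0.
  + have nt0 : 0 < - t by rewrite oppr_gt0.
    have : (- t)^-1 * r - p ((- t)^-1 *: x - x0) <= sup L.
      apply: ub_le_sup; first by case: hsL.
      by exists ((- t)^-1 *: x, (- t)^-1 * r) => //; exact: MZ.
    have -> : x + t *: x0 = (- t) *: ((- t)^-1 *: x - x0).
      by rewrite scalerBr scalerA divff ?scale1r ?scaleNr ?opprK// gt_eqF.
    rewrite p_homog// -(ler_pM2l nt0) mulrBr mulrA divff ?gt_eqF// mul1r; lra.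
  + have : sup L <= p (t^-1 *: x + x0) - t^-1 * r.
      by apply: ge_sup; [case: hsL|apply: Lub; exact: MZ].
    have -> : x + t *: x0 = t *: (t^-1 *: x + x0).
      by rewrite scalerDr scalerA divff ?scale1r// gt_eqF.
    rewrite p_homog// -(ler_pM2l t0) mulrBr mulrA divff ?gt_eqF// mul1r; lra.
  + by rewrite scale0r mul0r !addr0; exact: Mp.
Qed.

(** Zorn's lemma is applied to the sets whose union with [M] is dominated, so that the empty chain
    is covered too. A maximal such set is total by the one-step extension. *)
Lemma dominated_graph_total M : dominated_graph M ->
  exists N, [/\ dominated_graph N, M `<=` N & forall x, exists r, N (x, r)].
Proof.
move=> domM; pose P := [set A | dominated_graph (M `|` A)].
have [|A [PA Amax]] := @Zorn_bigcup _ P.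
  move=> F FP Ftot.
  (* The closure conditions involve at most two points, and along a chain two points always lie in
     [M] or in the union of [M] with a single member. *)
  have two u v : (M `|` \bigcup_(X in F) X) u -> (M `|` \bigcup_(X in F) X) v ->
      exists N, [/\ dominated_graph N, N `<=` M `|` \bigcup_(X in F) X,
        N u & N v].
    have sub X : F X -> M `|` X `<=` M `|` \bigcup_(X in F) X.
      by move=> FX; apply: setUS; exact: bigcup_sup.
    move=> [Mu|[X FX Xu]] [Mv|[Y FY Yv]].
    - by exists M; split=> // w; left.
    - by exists (M `|` Y); split; [exact: FP|exact: sub|left|right].
    - by exists (M `|` X); split; [exact: FP|exact: sub|right|left].
    - have [XY|YX] := Ftot _ _ FX FY.
        exists (M `|` Y).
        by split; [exact: FP|exact: sub|right; exact: XY|right].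
      by exists (M `|` X); split; [exact: FP|exact: sub|right|right; exact: YX].
  split.
  - by left; case: domM.
  - move=> a x y r s xr ys; have [N [[_ NL _] sub Nu Nv]] := two _ _ xr ys.
    by apply: sub; exact: NL.
  - move=> x r xr; have [N [[_ _ Np] _ Nu _]] := two _ _ xr xr.
    exact: Np.
exists (M `|` A); split; [exact: PA|exact: subsetUl|].
move=> x0; have [a domN] := dominated_graph_extend x0 PA.
set N := [set v | _] in domN.
have MAN : M `|` A `<=` N.
  by move=> [x r] xr; exists x, r, 0; rewrite scale0r mul0r !addr0.
have MN : M `<=` N by move=> v Mv; apply: MAN; left.
have AN : A `<=` N by move=> v Av; apply: MAN; right.
have PN : P N by rewrite /P /= ((setUidPr _ _).2 MN).
have Nx0 : N (x0, a).
  by exists 0, 0, 1; rewrite scale1r mul1r !add0r; split=> //; case: PA.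
(* [N] satisfies [P] and contains [A], so maximality forces [N] into [A], which then has a value at
   [x0]. *)
have [NA|NA] := pselect (N `<=` A); first by exists a; right; exact: NA.
by case: (Amax N _ PN).
Qed.

(** The pairs [(j y, f y)] form a dominated graph, single-valued by domination even when [j]
    identifies points. A total dominated graph above it is the graph of [g]. *)
Lemma hahn_banach (U : lmodType R) (j : U -> V) (f : U -> R) :
  linear j -> scalar f -> (forall y, f y <= p (j y)) ->
  exists g : V -> R,
    [/\ scalar g, forall y, g (j y) = f y & forall x, g x <= p x].
Proof.
move=> jlin flin fp.
have dom : dominated_graph [set v | exists y, v = (j y, f y)].
  split.
  - exists 0; congr (_, _).
      by have := jlin (-1) 0 0; rewrite scaleN1r addNr scaleN1r addNr.
    by have := flin (-1) 0 0; rewrite scaleN1r addNr mulN1r addNr.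
  - move=> a _ _ _ _ [y [-> ->]] [z [-> ->]].
    by exists (a *: y + z); rewrite jlin flin.
  - by move=> _ _ [y [-> ->]].
have [N [domN sub /choice[g Ng]]] := dominated_graph_total dom.
exists g; have [_ NL Np] := domN; split.
(* Linearity is uniqueness of values: both sides are values of [N] at [a *: x + y]. *)
- move=> a x y; apply: (dominated_graph_fun domN (Ng _)).
  by apply: NL; exact: Ng.
- by move=> y; apply: (dominated_graph_fun domN (Ng _)); apply: sub; exists y.
- by move=> x; exact/Np/Ng.
Qed.

End HahnBanach.

(** * Restriction of scalars to the reals, and lifting of real functionals *)

Section Realification.
Variables (R : realType) (k : scalars).
Local Notation K := (scalar_field R k).
Local Notation of_real := (@scal_of R k).
Local Notation re := (@scal_re R k).

Lemma scal_ofD r s : of_real (r + s) = of_real r + of_real s.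
Proof. by case: k => //=; rewrite rmorphD. Qed.

Lemma scal_ofM r s : of_real (r * s) = of_real r * of_real s.
Proof. by case: k => //=; rewrite rmorphM. Qed.

Lemma scal_of1 : of_real 1 = 1.
Proof. by case: k. Qed.

Lemma scal_reD (a b : K) : re (a + b) = re a + re b.
Proof. by case: k a b => //= a b; rewrite raddfD. Qed.

Lemma scal_reZ r (a : K) : re (of_real r * a) = r * re a.
Proof. by case: k a => //= -[x y] /=; rewrite mul0r subr0. Qed.

Lemma scal_re_eq0 (a : K) : (forall c : K, re (c * a) = 0) -> a = 0.
Proof.
move=> ca0; have [//|a0] := eqVneq a 0.
(* The factor [|a| / a] rotates [a] onto [|a|], which is determined by its real part. *)
have := ca0 (`|a| / a); rewrite mulfVK// => re0.
by apply/eqP; rewrite -normr_eq0 -(scal_reK (normr_ge0 a)) re0 scal_of0.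
Qed.

(** A separate name for [V], so that the real module structure can be attached without clashing with
    the one over [K]. *)
Definition realification (V : lmodType K) : Type := V.

Section RealificationModule.
Variable V : lmodType K.

HB.instance Definition _ := GRing.Zmodule.copy (realification V) V.

Let rscale (r : R) (v : realification V) : realification V :=
  of_real r *: (v : V).

Let rscalerA r s v : rscale r (rscale s v) = rscale (r * s) v.
Proof. by rewrite /rscale scalerA scal_ofM. Qed.

Let rscale1r : left_id 1 rscale.
Proof. by move=> v; rewrite /rscale scal_of1 scale1r. Qed.

Let rscalerDr : right_distributive rscale +%R.
Proof. by move=> r u v; rewrite /rscale scalerDr. Qed.

Let rscalerDl v : {morph rscale^~ v : r s / r + s}.
Proof. by move=> r s; rewrite /rscale scal_ofD scalerDl. Qed.

HB.instance Definition _ := GRing.Zmodule_isLmodule.Build R (realification V)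
  rscalerA rscale1r rscalerDr rscalerDl.

Lemma realification_scaleE r (v : realification V) :
  r *: v = of_real r *: (v : V) :> V.
Proof. by []. Qed.

End RealificationModule.

End Realification.

Lemma scalar_re_lift (R : realType) (k : scalars)
    (V : lmodType (scalar_field R k)) (g : realification V -> R) :
  scalar g -> exists2 f : V -> (scalar_field R k)^o, linear f &
    forall x, scal_re (f x) = g x.
Proof.
case: k V g => V g glin; first by exists g.
pose ii : scalar_field R ComplexScalars := 'i%C.
pose rc (r : R) : scalar_field R ComplexScalars := r%:C%C.
have gD (x y : V) : g (x + y : V) = g x + g y.
  by have := glin 1 x y; rewrite scale1r mul1r.
have g0 : g (0 : V) = 0 by have := gD 0 0; rewrite addr0; lra.
have gZ r (x : V) : g (rc r *: x : V) = r * g x.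
  by have := glin r x (0 : V); rewrite !addr0 g0 addr0.
have cE (c : scalar_field R ComplexScalars) :
    c = rc (complex.Re c) + rc (complex.Im c) * ii.
  by rewrite [LHS]complexE mulrC.
have iiM : ii * ii = rc (-1) by rewrite -expr2 [LHS]sqr_i /rc rmorphN rmorph1.
have gC c (z : V) :
    g (c *: z : V) = complex.Re c * g z + complex.Im c * g (ii *: z : V).
  by rewrite {1}(cE c) scalerDl -scalerA gD !gZ.
have gi (z : V) : g (ii *: (ii *: z : V) : V) = - g z.
  by rewrite scalerA iiM gZ mulN1r.
exists (fun x : V => (g x -i* g (ii *: x : V))%C) => // a x y.
have -> : ii *: (a *: x + y) = a *: (ii *: x) + ii *: y :> V.
  by rewrite scalerDr !scalerA mulrC.
(* Once [a] is split into real and imaginary parts and [i * i = -1] is used, linearity is a ring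
   identity in each component. *)
rewrite !gD !(gC a) gi; case: a => c d /=.
by apply/eqP; rewrite eq_complex /=; apply/andP; split; apply/eqP; ring.
Qed.

Lemma linear_norm_le_continuous (K : numFieldType) (E F : normedModType K)
    (u : E -> F) (M : K) :
  linear u -> 0 <= M -> (forall x, `|u x| <= M * `|x|) -> continuous u.
Proof.
move=> ulin M0 uM.
pose U : {linear E -> F} := HB.pack u (GRing.isLinear.Build _ _ _ _ _ ulin).
apply: (@bounded_linear_continuous _ _ _ U).
apply/linear_boundedP; near=> r => x.
rewrite (le_trans (uM x))// ler_wpM2r//.
by near: r; apply: nbhs_pinfty_ge; rewrite ger0_real.
Unshelve. all: by end_near. Qed.

(** * Bounds for polynomials, norm-preserving extension, composition operators *)

Section HomogSpaces.
Variables (R : realType) (k : scalars).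
Local Notation K := (scalar_field R k).

(** Continuity at 0 bounds [P] by [|P 0| + 1] on a small ball, and homogeneity carries the bound to
    the unit ball. Halving the radius keeps [(e / 2) *: x] inside the open ball; [P 0] may be
    nonzero in degree 0. *)
Lemma hpoly_bounded m (E F : normedModType K) (P : E -> F) : hpoly m P ->
  exists2 M : K, 0 <= M & forall x, `|x| <= 1 -> `|P x| <= M.
Proof.
move=> [/hpoly_homog PZ Pcont].
have /cvgrPdist_le/(_ 1 ltr01)/nbhs_norm0P[/= e e0 he] := Pcont 0.
have e20 : 0 < e / 2 by rewrite divr_gt0.
exists ((e / 2) ^- m * (`|P 0| + 1)).
  by rewrite mulr_ge0 ?addr_ge0 ?invr_ge0 ?exprn_ge0 ?(ltW e20).
move=> x x1; rewrite -[x](scalerK (lt0r_neq0 e20)) PZ.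
rewrite normrZ normrX normfV gtr0_norm// exprVn.
rewrite ler_wpM2l ?invr_ge0 ?exprn_ge0 ?(ltW e20)//.
have := he ((e / 2) *: x); rewrite /= normrZ gtr0_norm// => he1.
have {}he1 : `|P 0 - P ((e / 2) *: x)| <= 1.
  apply: he1; rewrite (@le_lt_trans _ _ (e / 2))//.
    by rewrite ler_piMr// ltW.
  by rewrite ltr_pdivrMr// ltr_pMr// ltr1n.
rewrite -lerBlDl (le_trans (lerB_dist _ _))//.
by rewrite distrC in he1.
Qed.

Lemma algebraic_hpoly1P (E F : lmodType K) (u : E -> F) :
  algebraic_hpoly 1 u <-> linear u.
Proof.
split=> [[A Alin uA] a x y|ulin].
  have e z : (fun=> z) = (fun j : 'I_1 => if j == ord0 then z else 0).
    by apply/funext => j; rewrite (ord1 j).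
  by rewrite !uA !e Alin.
by exists (fun v => u (v ord0)) => // i v a x y; rewrite (ord1 i) /= ulin.
Qed.

Lemma operator_hpoly (E F : banach R k) (u : E -> F) :
  operator u -> hpoly 1 u.
Proof. by move=> [/algebraic_hpoly1P]. Qed.

Lemma scal_re_le_norm (a : K) : scal_re a <= scal_re `|a|.
Proof.
case: k a => /= a; first exact: ler_norm.
case: a => x y; change (x <= complex.Re (`|(x +i* y)%C| : R[i]%C)).
rewrite normc_def /=; apply: le_trans (ler_norm x) _.
by rewrite -sqrtr_sqr ler_wsqrtr// lerDl sqr_ge0.
Qed.

(** For nonzero [a], the unimodular [c = |a| / a] turns [a] into [|a|]. *)
Lemma normr_le_scal_re (a b : K) : 0 <= b ->
  (forall c : K, `|c| = 1 -> scal_re (c * a) <= scal_re b) -> `|a| <= b.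
Proof.
move=> b0 ab; have [->|a0] := eqVneq a 0; first by rewrite normr0.
rewrite -ler_scal_re//; have := ab (`|a| / a); rewrite mulfVK//; apply.
by rewrite normrM normfV normr_id mulfV// normr_eq0.
Qed.

(** The real part of [phi] is extended below [|phi| |x|], and the extension is lifted to a
    [K]-linear [psi]. Rotation by unimodular scalars turns the bound on real parts into a bound on
    [psi]. *)
Lemma hahn_banach_dual (F G : banach R k) (j : F -> G) (phi : dual F) :
  metric_injection j ->
  exists2 psi : dual G, (forall y, psi (j y) = phi y) & `|psi| <= `|phi|.
Proof.
move=> [jlin jnorm].
pose p (x : realification G) : R := scal_re (`|phi| * `|x : G|).
have p_subadd x y : p (x + y) <= p x + p y.
  rewrite /p -scal_reD -mulrDr ler_scal_re ?mulr_ge0 ?addr_ge0//.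
  by rewrite ler_wpM2l// ler_normD.
have p_homog r x : 0 < r -> p (r *: x) = r * p x.
  move=> r0; rewrite /p realification_scaleE normrZ mulrCA ger0_norm.
    by rewrite scal_reZ.
  by rewrite -(scal_of0 R k) ler_scal_of ltW.
have phibound y : `|phi y| <= `|phi| * `|y| by exact: (sup_normP phi).
have relin : scalar (fun y : realification F => scal_re (phi y)).
  move=> r x y; rewrite -scal_reZ -scal_reD; congr scal_re.
  exact: (homogP phi).
have jlinR : linear (j : realification F -> realification G).
  by move=> r x y; exact: jlin.
have [|g [glin gj gp]] := hahn_banach p_subadd p_homog jlinR relin.
  move=> y; rewrite (le_trans (scal_re_le_norm _))//.
  by rewrite /p jnorm ler_scal_re// ?mulr_ge0//; exact: phibound.
have [psi psilin psig] := scalar_re_lift glin.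
pose Psi : {linear G -> K^o} :=
  HB.pack psi (GRing.isLinear.Build _ _ _ _ _ psilin).
pose Phi : {linear F -> K^o} :=
  HB.pack (phi : F -> K^o) (GRing.isLinear.Build _ _ _ _ _ (homogP phi)).
have psiZ (c : K) x : c * psi x = psi (c *: x).
  by rewrite -[RHS]/(Psi _) linearZ.
have phiZ (c : K) y : c * phi y = phi (c *: y).
  by rewrite -[RHS]/(Phi _) linearZ.
have jZ (c : K) y : j (c *: y) = c *: j y.
  pose J : {linear F -> G} := HB.pack j (GRing.isLinear.Build _ _ _ _ _ jlin).
  by rewrite -[LHS]/(J _) linearZ.
have psibound x : `|psi x| <= `|phi| * `|x|.
  apply: normr_le_scal_re; first by rewrite mulr_ge0.
  move=> c c1.
  by rewrite psiZ psig (le_trans (gp _))// /p normrZ c1 mul1r.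
(* Any factor [c] moves inside both functionals by linearity, so [c * psi (j y)] and [c * phi y]
   have equal real parts. *)
have psij y : psi (j y) = phi y.
  apply/eqP; rewrite -subr_eq0; apply/eqP/scal_re_eq0 => c.
  apply: (addIr (scal_re (phi (c *: y)))).
  by rewrite mulrBr psiZ phiZ -jZ -scal_reD subrK add0r psig gj.
have psicont : continuous psi.
  by apply: (@linear_norm_le_continuous _ _ _ _ `|phi|).
have Hpsi : homog_pred (linear_class G) psi by apply/asboolP.
exists (HomogSpace Hpsi) => //.
apply: sup_norm_le => // x x1; rewrite (le_trans (psibound x))//.
by rewrite ler_piMr.
Qed.

Lemma operator_metric_injection (F G : banach R k) (j : F -> G) :
  metric_injection j -> operator j.
Proof.
move=> [jlin jnorm]; split=> //.
by apply: (linear_norm_le_continuous (M := 1)) => // x; rewrite jnorm mul1r.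
Qed.

(** Two homogeneous classes appear so that one statement covers linear and polynomial adjoints,
    precomposition by an operator, and the passage between [E^*] and [P(^1E)]. The norm of [T] is at
    most [M] to the degree of [S]. *)
Lemma precomp_operator (E F : banach R k) (S : homog_class F)
    (S' : homog_class E) (P : E -> F) (M : K)
    (T : homog_space S -> homog_space S') :
  0 <= M -> (forall x, `|x| <= 1 -> `|P x| <= M) ->
  (forall f x, T f x = f (P x)) -> linear T /\ continuous T.
Proof.
move=> M0 PM TE.
have Tlin : linear T.
  move=> a f g; apply/val_inj/funext => x.
  change (T (a *: f + g) x = a *: (T f x : K^o) + T g x).
  by rewrite !TE.
split=> //.
apply: (linear_norm_le_continuous (M := M ^+ hdegree S)) => //.
  by rewrite exprn_ge0.
move=> f; apply: sup_norm_le; first by rewrite mulr_ge0 ?exprn_ge0.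
move=> x x1; rewrite TE (le_trans (sup_normP f _))//.
rewrite mulrC ler_wpM2r ?sup_norm_ge0//.
by rewrite lerXn2r// ?nnegrE// PM.
Qed.

End HomogSpaces.

(** * Polynomial adjoints and the ideal properties of the polynomial dual *)

Section PolynomialDual.
Variables (R : realType) (k : scalars).
Local Notation K := (scalar_field R k).

Lemma operator_bounded (E F : banach R k) (u : E -> F) : operator u ->
  exists2 M : K, 0 <= M & forall x, `|x| <= 1 -> `|u x| <= M.
Proof. by move=> /operator_hpoly/hpoly_bounded. Qed.

Lemma operator_id (E : banach R k) : operator (@id E).
Proof. by split=> // x; exact: cvg_id. Qed.

Lemma operator_hpoly_adjoint m (E F : banach R k) (P : E -> F)
  (hP : hpoly m P) : operator (hpoly_adjoint hP).
Proof.
by have [M M0 PM] := hpoly_bounded hP; exact: precomp_operator M0 PM _.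
Qed.

Lemma operator_adjoint (E F : banach R k) (u : E -> F) (hu : operator u) :
  operator (adjoint hu).
Proof.
by have [M M0 uM] := operator_bounded hu; exact: precomp_operator M0 uM _.
Qed.

Lemma hpoly0 m (E F : normedModType K) : hpoly m ((fun=> 0) : E -> F).
Proof.
split; last by move=> x; exact: cvg_cst.
by exists (fun=> 0) => // i v a x y; rewrite scaler0 addr0.
Qed.

Lemma hpolyP m (E F : normedModType K) (a : K) (P Q : E -> F) :
  hpoly m P -> hpoly m Q -> hpoly m (fun x => a *: P x + Q x).
Proof.
move=> [[A Alin PA] Pc] [[B Blin QB] Qc]; split.
  exists (fun v => a *: A v + B v) => [i v b x y|x]; last by rewrite PA QB.
  by rewrite Alin Blin !scalerDr !scalerA [b * a]mulrC addrACA.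
by move=> x; apply: cvgD; [apply: cvgZl_tmp; exact: Pc | exact: Qc].
Qed.

Lemma hpoly_comp m (E F G H : normedModType K) (t : G -> H) (P : F -> G)
    (u : E -> F) : linear t -> continuous t -> hpoly m P -> linear u ->
  continuous u -> hpoly m (t \o P \o u).
Proof.
move=> tlin tc [[A Alin PA] Pc] ulin uc; split.
  exists (fun v => t (A (u \o v))) => [i v a x y|x] /=; last by rewrite PA.
  have e z : u \o (fun l => if l == i then z else v l) =
      (fun l => if l == i then u z else u (v l)).
    by apply/funext => l /=; case: eqP.
  by rewrite !e ulin Alin tlin.
move=> x; apply: continuous_comp; first exact: uc.
by apply: continuous_comp; [exact: Pc|exact: tc].
Qed.

Lemma hpoly_pow m (E F : normedModType K) (phi : E -> K^o) (y : F) :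
  linear phi -> continuous phi -> hpoly m (fun x => (phi x : K) ^+ m *: y).
Proof.
move=> philin phic; split; last first.
  move=> x; apply: cvgZr_tmp; elim: m => [|m IH].
    by rewrite expr0; exact: cvg_cst.
  rewrite exprS; under eq_fun do rewrite exprS.
  by apply: cvgM; [exact: phic|exact: IH].
exists (fun v => (\prod_(l < m) (phi (v l) : K)) *: y).
  move=> i v a x z.
  have prodE w : \prod_(l < m) (phi (if l == i then w else v l) : K) =
      phi w * \prod_(l < m | l != i) (phi (v l) : K).
    by rewrite (bigD1 i)//= eqxx; congr (_ * _); apply: eq_bigr => l /negbTE ->.
  by rewrite !prodE philin scalerA -scalerDl mulrA -mulrDl.
by move=> x; rewrite prodr_const card_ord.
Qed.

Lemma finite_type_hpoly m (E F : banach R k) (P : E -> F) :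
  finite_type m P -> hpoly m P.
Proof.
move=> [n [phi [y PE]]]; rewrite (funext PE) {P PE}.
elim: n phi y => [|n IH] phi y.
  by under eq_fun do rewrite big_ord0; exact: hpoly0.
under eq_fun do rewrite big_ord_recl -[X in X + _]scale1r.
apply: hpolyP; last exact: (IH (fun i => phi (lift ord0 i))).
by apply: hpoly_pow; [exact: (homogP (phi _))|exact: homog_continuous].
Qed.

(** [P^* psi] is the sum of the [psi (y i)] times the [m]-th powers of the [phi i], so these powers
    span the range. *)
Lemma hpoly_adjoint_finite_type m (E F : banach R k) (P : E -> F)
  (hP : hpoly m P) : finite_type m P -> finite_rank (hpoly_adjoint hP).
Proof.
move=> [n [phi [y PE]]]; split; first exact: operator_hpoly_adjoint.
have powP i : homog_pred (hpoly_class E m) (fun x => (phi i x : K) ^+ m).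
  have [Palg Pc] := hpoly_pow m (1 : K^o) (homogP (phi i))
    (@homog_continuous _ _ _ _ (phi i)).
  apply/asboolP; rewrite (_ : (fun x => _) =
      fun x => (phi i x : K) ^+ m *: (1 : K^o))//.
  by apply/funext => x; rewrite [RHS]mulr1.
exists n, (fun i => HomogSpace (powP i)) => psi.
exists (fun i => psi (y i)); apply/val_inj/funext => x.
pose Psi : {linear F -> K^o} :=
  HB.pack (psi : F -> K^o) (GRing.isLinear.Build _ _ _ _ _ (homogP psi)).
rewrite [RHS](big_morph (fun f : hpoly_space m E => f x)
  (op1 := +%R) (id1 := 0))//.
rewrite -[LHS]/(Psi (P x)) PE linear_sum; apply: eq_bigr => i _.
by rewrite linearZ [LHS]mulrC.
Qed.

Section Ideal.
Variable I : op_class R k.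
Hypothesis I_ideal : operator_ideal I.

(** Stability under composition rests on writing the adjoint of [t \o P \o u] as
    [pre \o P^* \o t^*], where [pre] precomposes with [u]. *)
Lemma polynomial_dual_ideal : polynomial_ideal (polynomial_dual I).
Proof.
split.
- by move=> m E F P _ [].
- move=> m E F a P Q _ [hP IP] [hQ IQ].
  exists (hpolyP a hP hQ).
  rewrite (_ : hpoly_adjoint _ =
      fun psi => a *: hpoly_adjoint hP psi + hpoly_adjoint hQ psi).
    exact: op_ideal_linear.
  by apply/funext => psi; apply/val_inj/funext => x; exact: (homogP psi).
- move=> m E F P _ ftP; exists (finite_type_hpoly ftP).
  exact/(op_ideal_finite_rank I_ideal)/hpoly_adjoint_finite_type.
- move=> m E F G H t P u _ ht [hP IP] hu.
  have [[tlin tc] [ulin uc]] := (ht, hu).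
  exists (hpoly_comp tlin tc hP ulin uc).
  have preP (f : hpoly_space m F) :
      homog_pred (hpoly_class E m) (fun x => f (u x)).
    apply/asboolP.
    have hf : hpoly m f by split; [exact: (homogP f)|exact: homog_continuous].
    by apply: (hpoly_comp (t := id) _ _ hf ulin uc) => // x; exact: cvg_id.
  pose pre f : hpoly_space m E := HomogSpace (preP f).
  have hpre : operator pre.
    have [M M0 uM] := operator_bounded hu.
    by apply: (precomp_operator (S := hpoly_class F m)
      (S' := hpoly_class E m) M0 uM).
  have := op_ideal_comp I_ideal hpre IP (operator_adjoint ht).
  by congr I; apply/funext => psi; apply/val_inj.
Qed.

(** The adjoint of [v \o q] is [q^* \o v^*], and [q^*] is a metric injection because [q] is a metric
    surjection. Injectivity cancels [q^*]; symmetry passes to adjoints and back. *)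
Lemma injective_symmetric_surjective (W X Y : banach R k) (q : W -> X)
    (v : X -> Y) :
  injective_operator_ideal I -> symmetric_ideal I ->
  operator q -> operator v -> (forall w, `|q w| <= `|w|) ->
  (forall x, exists2 w, q w = x & `|w| <= `|x|) ->
  I (v \o q) -> I v.
Proof.
move=> [_ Iinj] Isym hq hv q1 qsurj /Isym[hvq Ivq].
apply/Isym; exists hv; apply: (Iinj _ _ _ _ (adjoint hq)).
- exact: operator_adjoint.
- split; first by have [] := operator_adjoint hq.
  (* One inequality holds because [q] does not increase norms, the other because each point of the
     unit ball of [X] lifts to the unit ball of [W]. *)
  move=> xi; apply/eqP; rewrite eq_le; apply/andP; split.
    apply: sup_norm_le => // w w1.
    by rewrite (sup_norm_ub xi)// (le_trans (q1 w)).
  apply: sup_norm_le => // x x1; have [w qw wx] := qsurj x.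
  by rewrite -qw; apply: (sup_norm_ub (adjoint hq xi)); exact: le_trans wx x1.
- by move: Ivq; congr I; apply/funext => psi; apply/val_inj.
Qed.

End Ideal.
End PolynomialDual.

(** * Equivalence of the two injectivity properties *)

Theorem corollary3p8 (R : realType) (k : scalars) (I : op_class R k) :
  operator_ideal I -> symmetric_ideal I ->
  (injective_operator_ideal I <->
   injective_polynomial_ideal (polynomial_dual I)).
Proof.
move=> I_ideal Isym; split.
  move=> Iinj; split; first exact: polynomial_dual_ideal.
  move=> m E F G P j _ hP mj [hjP IjP]; exists hP.
  have hj := operator_metric_injection mj.
  (* Here [v] is [P^*], and [v \o q] is the adjoint of [j \o P]. *)
  apply: (injective_symmetric_surjective (q := adjoint hj)) => //.
  - exact: operator_adjoint.
  - exact: operator_hpoly_adjoint.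
  - move=> psi; apply: sup_norm_le => // y y1.
    by rewrite (sup_norm_ub psi)// (proj2 mj).
  (* Norm-preserving extension gives a preimage of [phi] under [j^*] of no larger norm. *)
  - move=> phi; have [psi psij psile] := hahn_banach_dual phi mj.
    by exists psi => //; apply/val_inj/funext.
  - by move: IjP; congr I; apply/funext => psi; apply/val_inj.
move=> [_ Pinj]; split=> // E F G u j hu mj Iju.
have [hju Iadj] := (Isym _ _ _).1 Iju.
(* [E^*] and [P(^1E)] consist of the same functions but are distinct types. The conversions both
   ways are operators, so composing with them preserves membership in [I]. *)
have to1 (f : dual E) : homog_pred (hpoly_class E 1) f.
  apply/asboolP; split; last exact: homog_continuous.
  exact/algebraic_hpoly1P/(homogP f).
have of1 (f : hpoly_space 1 E) : homog_pred (linear_class E) f.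
  apply/asboolP; split; last exact: homog_continuous.
  exact/algebraic_hpoly1P/(homogP f).
have id1 (x : E) : `|x| <= 1 -> `|id x| <= 1 by [].
have hto1 : operator (fun f => HomogSpace (to1 f) : hpoly_space 1 E).
  by apply: (precomp_operator (S := linear_class E)
    (S' := hpoly_class E 1) ler01 id1).
have hof1 : operator (fun f => HomogSpace (of1 f) : dual E).
  by apply: (precomp_operator (S := hpoly_class E 1)
    (S' := linear_class E) ler01 id1).
(* In degree 1 the polynomial adjoint of [j \o u] is its linear adjoint followed by the conversion
   into [P(^1E)]. *)
have [|hpu Ipu] := Pinj 1%N E F G u j isT (operator_hpoly hu) mj.
  exists (operator_hpoly hju).
  have := op_ideal_comp I_ideal hto1 Iadj (operator_id _).
  by congr I; apply/funext => psi; apply/val_inj.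
apply/Isym; exists hu.
have := op_ideal_comp I_ideal hof1 Ipu (operator_id _).
by congr I; apply/funext => psi; apply/val_inj.
Qed.
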